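(* Let $X=\min\{g_{sr},g_{sd}\}$ and $$\bar C_{s_1,\mathrm{SC}}:=\tfrac12\,\mathbb E\Big[\log_2\Big(1+\tfrac{a_1\rho X}{a_2\rho X+1}\Big)\Big]=\tfrac12\,\mathbb E\big[\log_2(1+\rho X)-\log_2(1+a_2\rho X)\big].$$ Then \begin{align*} \bar C_{s_1,\mathrm{SC}}=\frac{1}{2\ln 2}&\sum_{\substack{k_0+\cdots+k_{m_{sr}}=N_r\\ k_0\neq N_r}}\ \sum_{\substack{l_0+\cdots+l_{m_{sd}}=N_d\\ l_0\neq N_d}}\binom{N_r}{k_0,\ldots,k_{m_{sr}}}\binom{N_d}{l_0,\ldots,l_{m_{sd}}}(-1)^{N_r+N_d-k_0-l_0}\\ &\times\Big\{\prod_{\mu=0}^{m_{sr}-1}\Big(\tfrac{1}{\mu!}\Big)^{k_{\mu+1}}\Big\}\Big(\tfrac{m_{sr}}{\Omega_{sr}}\Big)^{\tau}\Big\{\prod_{\nu=0}^{m_{sd}-1}\Big(\tfrac{1}{\nu!}\Big)^{l_{\nu+1}}\Big\}\Big(\tfrac{m_{sd}}{\Omega_{sd}}\Big)^{\omega}\frac{\Gamma(\tau+\omega+1)}{\rho^{\tau+\omega}}\\ &\times\Big\{e^{\Psi_{k_0,l_0}/\rho}\,\Gamma\Big[-\tau-\omega,\tfrac{\Psi_{k_0,l_0}}{\rho}\Big]-\frac{1}{a_2^{\tau+\omega}}e^{\Psi_{k_0,l_0}/(\rho a_2)}\,\Gamma\Big[-\tau-\omega,\tfrac{\Psi_{k_0,l_0}}{\rho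 a_2}\Big]\Big\}, \end{align*} where $\tau=\sum_{\mu=0}^{m_{sr}-1}\mu k_{\mu+1}$, $\omega=\sum_{\nu=0}^{m_{sd}-1}\nu l_{\nu+1}$ and $\Psi_{k_0,l_0}=\frac{(N_r-k_0)m_{sr}}{\Omega_{sr}}+\frac{(N_d-l_0)m_{sd}}{\Omega_{sd}}$.
   Context: Let $N_r,N_d$ be positive integers, $m_{sr},m_{sd},m_{rd}$ positive integers, and $\Omega_{sr},\Omega_{sd},\Omega_{rd}>0$. Let $\{G_{sr,i}\}_{i=1}^{N_r}$, $\{G_{sd,j}\}_{j=1}^{N_d}$, $\{G_{rd,k}\}_{k=1}^{N_d}$ be mutually independent random variables, where each $G_{sr,i}$ has the Gamma density $f(x)=\frac{(m_{sr}/\Omega_{sr})^{m_{sr}}x^{m_{sr}-1}}{\Gamma(m_{sr})}e^{-m_{sr}x/\Omega_{sr}}$, $x>0$ (shape $m_{sr}$, mean $\Omega_{sr}$; these are the squared magnitudes of Nakagami-$m$ channel gains), and analogously $G_{sd,j}$ with parameters $(m_{sd},\Omega_{sd})$ and $G_{rd,k}$ with $(m_{rd},\Omega_{rd})$. Selection combining (SC) gains: $g_{sr}=\max_i G_{sr,i}$, $g_{sd}=\max_j G_{sd,j}$, $g_{rd}=\max_k G_{rd,k}$. Let $\rho>0$ (transmit SNR) and power-allocation coefficients $a_1,a_2\in(0,1)$ with $a_1+a_2=1$, $a_1>a_2$. Sums $\sum_{k_0+\cdots+k_{m}=N,\,k_0\neq N}$ run over tuples of nonnegative integers $(k_0,\dots,k_m)$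 summing to $N$ with $k_0\ne N$, and $\binom{N}{k_0,\ldots,k_m}$ is the multinomial coefficient. $\Gamma(\cdot)$ is the Gamma function and $\Gamma[s,z]=\int_z^\infty t^{s-1}e^{-t}\,dt$ ($z>0$, any real $s$) is the upper incomplete Gamma function. *)

(* Defs.v *)
From HB Require Import structures.
From mathcomp Require Import all_boot all_order all_algebra.
From mathcomp Require Import all_classical all_reals all_analysis.
Set Implicit Arguments. Unset Strict Implicit. Unset Printing Implicit Defensive.
Import Order.TTheory GRing.Theory Num.Theory.
Import numFieldNormedType.Exports.
Local Open Scope classical_set_scope.
Local Open Scope ring_scope.

Section defs.
Context {R : realType}.

Definition Gamma (s : R) : R :=
  fine (\int[@lebesgue_measure R]_(t in ([set` `]0, +oo[%R] : set R)) (powR t (s - 1) * expR (- t))%:E)%E.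

Definition upper_gamma (s z : R) : R :=
  fine (\int[@lebesgue_measure R]_(t in ([set` `[z, +oo[%R] : set R)) (powR t (s - 1) * expR (- t))%:E)%E.

(* Gamma density with shape m and mean Om *)
Definition gamma_pdf (m : nat) (Om : R) (x : R) : R :=
  if 0 < x then
    (m%:R / Om) ^+ m * x ^+ m.-1 / Gamma m%:R * expR (- (m%:R * x / Om))
  else 0.

Definition log2 (x : R) : R := ln x / ln 2.

(* maximum of the finite family F (for n > 0 this is the true maximum) *)
Definition sc_max (n : nat) (F : 'I_n -> R) : R :=
  let s := [seq F i | i <- enum 'I_n] in \big[Num.max/head 0 s]_(x <- s) x.

Definition has_density d (T : measurableType d) (P : probability T R)
    (X : T -> R) (f : R -> R) : Prop :=
  forall A : set R, measurable A ->
    P (X @^-1` A) = (\int[@lebesgue_measure R]_(x in A) (f x)%:E)%E.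

Definition mutually_independent d (T : measurableType d) (P : probability T R)
    (I : finType) (X : I -> T -> R) : Prop :=
  forall A : I -> set R, (forall i, measurable (A i)) ->
    P (\bigcap_(i in [set: I]) (X i @^-1` A i)) =
    (\big[*%E/1%E]_(i : I) P (X i @^-1` A i))%E.
End defs.

Definition multinom (m N : nat) (k : {ffun 'I_m.+1 -> 'I_N.+1}) : nat :=
  (N`! %/ \prod_(i < m.+1) (k i)`!)%N.

Definition comps (m N : nat) : {set {ffun 'I_m.+1 -> 'I_N.+1}} :=
  [set k : {ffun 'I_m.+1 -> 'I_N.+1} |
    ((\sum_(i < m.+1) (k i : nat)) == N)%N && ((k ord0 : nat) != N)]%SET.

Definition tau_of (m N : nat) (k : {ffun 'I_m.+1 -> 'I_N.+1}) : nat :=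
  (\sum_(mu < m) mu * k (lift ord0 mu))%N.

Definition inv_fact_prod {R : realType} (m N : nat) (k : {ffun 'I_m.+1 -> 'I_N.+1}) : R :=
  \prod_(mu < m) ((mu`!)%:R^-1) ^+ (k (lift ord0 mu)).

Definition all_gains {T R : Type} (Nr Nd : nat) (Gsr : 'I_Nr -> T -> R)
    (Gsd Grd : 'I_Nd -> T -> R) : ('I_Nr + 'I_Nd + 'I_Nd)%type -> T -> R :=
  fun i => match i with
           | inl (inl a) => Gsr a
           | inl (inr b) => Gsd b
           | inr c => Grd c
           end.
Arguments inv_fact_prod {R m N} k.
Arguments multinom {m N} k.
Arguments tau_of {m N} k.

(* Main.v *)
Require Import Defs.
From HB Require Import structures.
From mathcomp Require Import all_boot all_order all_algebra.
From mathcomp Require Import all_classical all_reals all_analysis.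
From mathcomp Require Import measurable_realfun ring lra zify.
Import Order.TTheory GRing.Theory Num.Theory.
Import numFieldNormedType.Exports.
Local Open Scope classical_set_scope.
Local Open Scope ring_scope.

(** For [X > 0] the capacity is the integral over [[0, X]] of a nonnegative
    density, a difference of two terms [c / (1 + c t)] up to a constant, so by
    Tonelli its expectation is the integral of that density against [P (X > t)].
    Independence gives [P (X > t) = (1 - Fsr(t)^Nr) (1 - Fsd(t)^Nd)], where the
    Gamma distribution functions with integer shape are [1] minus an exponential
    times a truncated exponential series; the multinomial theorem turns this
    product into a linear combination of terms [t^n e^(-Psi t)].  Finally
    [int t^n e^(-Psi t) c / (1 + c t) dt = n! c^(-n) e^(Psi/c) Gamma(-n, Psi/c)],
    again by Tonelli, from [n! / s^(n+1) = int x^n e^(-s x) dx]. *)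

(** * Multinomial expansion *)

(** Makes the Euclidean division in [multinom] exact. Each induction step splits off one binomial
    coefficient. *)
Lemma prod_fact_dvdn (I : Type) (r : seq I) (k : I -> nat) :
  (\prod_(i <- r) (k i)`! %| (\sum_(i <- r) k i)`!)%N.
Proof.
elim: r => [|i r IH]; first by rewrite !big_nil.
rewrite !big_cons; apply: dvdn_trans (dvdn_mul (dvdnn _) IH) _.
rewrite -(bin_fact (leq_addr (\sum_(j <- r) k j) (k i)))%N addKn.
exact: dvdn_mull.
Qed.

Lemma natr_fact_neq0 (F : numFieldType) n : (n`!)%:R != 0 :> F.
Proof. by rewrite pnatr_eq0 -lt0n fact_gt0. Qed.

(** Polynomial form of [exp(u X) exp(v X) = exp((u + v) X)]: cutting every exponential series at
    degree [B] leaves the coefficients of degree at most [B] unchanged. *)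
Lemma coef_prod_exp_trunc (F : numFieldType) (B : nat) (I : Type) (r : seq I)
    (y : I -> F) (N : nat) : (N <= B)%N ->
  (\prod_(i <- r) \sum_(j < B.+1) (y i ^+ j / (j`!)%:R) *: 'X^j)`_N =
  (\sum_(i <- r) y i) ^+ N / (N`!)%:R.
Proof.
elim: r N => [|i r IH] N leNB.
  by rewrite !big_nil coef1 expr0n; case: N leNB => [|N] _; rewrite ?divr1 ?mul0r.
(* After commuting the product, [j] is the degree taken from the tail both in the Cauchy product and
   in the binomial formula, so the two sums match termwise. *)
rewrite !big_cons mulrC coefM exprDn mulr_suml; apply: eq_bigr => j _.
have leNjB : (N - j < B.+1)%N by rewrite ltnS (leq_trans (leq_subr _ _)).
have lejN : (j <= N)%N by rewrite -ltnS.
have lejB : (j <= B)%N by exact: leq_trans leNB.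
rewrite IH// coef_sum (bigD1 (Ordinal leNjB))//= coefZ coefXn eqxx mulr1.
rewrite [X in _ * (_ + X)]big1 ?addr0; last first.
  move=> a anej.
  rewrite coefZ coefXn; case: eqP => [e|]; last by rewrite mulr0.
  by case/eqP: anej; apply: val_inj; rewrite /= e.
rewrite -(bin_fact lejN) !natrM -mulr_natr.
have b0 : 'C(N, j)%:R != 0 :> F by rewrite pnatr_eq0 -lt0n bin_gt0.
have := natr_fact_neq0 F j; have := natr_fact_neq0 F (N - j).
by move=> f1 f2; field; rewrite f1 f2 b0.
Qed.

Lemma multinomial_expansion (F : numFieldType) (m N : nat) (y : 'I_m.+1 -> F) :
  (\sum_i y i) ^+ N =
  \sum_(k : {ffun 'I_m.+1 -> 'I_N.+1} | (\sum_i (k i : nat) == N)%N)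
    (multinom k)%:R * \prod_i y i ^+ k i.
Proof.
(* The power is [N!] times a coefficient of a product of truncated exponentials. Truncating at [N]
   itself lets distributivity produce functions into ['I_N.+1], and the degree condition becomes the
   sum constraint. *)
have /(canRL (divfK (natr_fact_neq0 F N))) -> :=
  esym (coef_prod_exp_trunc F N _ (index_enum 'I_m.+1) y N (leqnn N)).
rewrite bigA_distr_bigA /= coef_sum mulr_suml [RHS]big_mkcond /=.
apply: eq_bigr => k _.
rewrite scaler_prod coefZ prodrXr coefXn prodf_div eq_sym.
case: eqP => [kN|_]; last by rewrite mulr0 mul0r.
have dv := prod_fact_dvdn _ (index_enum 'I_m.+1) (fun i => k i : nat).
rewrite kN in dv.
by rewrite mulr1 /multinom natf_div// natr_prod mulrAC [RHS]mulrAC [in RHS](mulrC N`!%:R).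
Qed.

(* The tuple with [k_0 = N] contributes the summand [1] of the expansion. *)
Lemma sub1_exp_erlang_cdf (R : realType) (m N : nat) (z e : R) :
  1 - (1 - e * \sum_(mu < m) z ^+ mu / (mu`!)%:R) ^+ N =
  - \sum_(k in comps m N) (multinom k)%:R * (-1) ^+ (N - k ord0) *
      inv_fact_prod k * z ^+ tau_of k * e ^+ (N - k ord0).
Proof.
(* Index [0] carries the constant [1] and index [mu + 1] the [mu]-th series term, the same shift as
   in [tau_of] and [inv_fact_prod]. *)
pose y (i : 'I_m.+1) : R :=
  if unlift ord0 i is Some mu then - e * (z ^+ mu / (mu`!)%:R) else 1.
have -> : 1 - e * \sum_(mu < m) z ^+ mu / (mu`!)%:R = \sum_i y i.
  rewrite big_ord_recl /y unlift_none -mulNr mulr_sumr; congr (_ + _).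
  by apply: eq_bigr => mu _; rewrite liftK.
rewrite multinomial_expansion.
pose kN : {ffun 'I_m.+1 -> 'I_N.+1} := [ffun i => if i == ord0 then ord_max else ord0].
have kN_sum : (\sum_i (kN i : nat) == N)%N.
  by rewrite big_ord_recl ffunE eqxx /= big1 ?addn0// => i _; rewrite ffunE.
rewrite (bigD1 kN)//= opprD addrA.
have -> : (multinom kN)%:R * \prod_i y i ^+ kN i = 1.
  rewrite /multinom !big_ord_recl /= ffunE eqxx /=.
  rewrite !big1 => [|i _|i _]; rewrite ?ffunE//=.
  by rewrite muln1 divnn fact_gt0 /y unlift_none expr1n !mulr1.
rewrite subrr sub0r; congr (- _).
(* If the entries sum to [N] and the first equals [N], all others vanish; so excluding the tuple
   [kN] is the same as requiring [k ord0 != N]. *)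
apply: eq_big => k.
  rewrite inE; apply: andb_id2l => /eqP sk; apply/idP/idP; apply: contra.
    move/eqP => k0; apply/eqP/ffunP => i; apply: val_inj.
    rewrite ffunE; case: eqP => [-> //|/eqP i0].
    move/eqP: sk; rewrite (bigD1 ord0)//= k0 -[X in _ == X]addn0 eqn_add2l.
    by rewrite sum_nat_eq0 => /forallP /(_ i); rewrite i0 => /eqP.
  by move=> /eqP ->; rewrite ffunE eqxx.
move=> /andP[/eqP sk _].
(* This spreads the powers of [-1] and [e] over the factors of the product, where they meet the
   powers of [- e]. *)
have -> : (N - k ord0 = \sum_(mu < m) k (lift ord0 mu))%N.
  by rewrite -{1}sk big_ord_recl addKn.
rewrite -!mulrA; congr (_ * _).
rewrite big_ord_recl /y unlift_none expr1n mul1r.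
under eq_bigr do rewrite liftK.
rewrite /inv_fact_prod /tau_of -!prodrXr -!big_split /=; apply: eq_bigr => mu _.
by rewrite exprMn [(- e) ^+ _]exprNn [(z ^+ mu / _) ^+ _]exprMn -exprM; ring.
Qed.

(** * Gamma integrals with integer shape *)

(** For [c > 0] and [x >= 0], the probability that a Gamma variable of shape [n + 1] and rate [c]
    exceeds [x]. *)
Definition erlang_tail {R : realType} (c : R) (n : nat) (x : R) : R :=
  expR (- (c * x)) * \sum_(k < n.+1) (c * x) ^+ k / (k`!)%:R.

(** The derivative telescopes: differentiating the power in the newly added term cancels the
    derivative of the preceding tail, and only the top-degree term survives. *)
Lemma is_derive_erlang_tail (R : realType) (c : R) (n : nat) (x : R) :
  is_derive x 1 (erlang_tail c n)
    (- (c ^+ n.+1 / (n`!)%:R * (x ^+ n * expR (- (c * x))))).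
Proof.
have dexp : is_derive x 1 (fun x => expR (- (c * x))) (- c * expR (- (c * x))).
  apply: is_derive_eq.
  by rewrite /GRing.scale /=; ring.
elim: n => [|n IH].
  rewrite (_ : erlang_tail c 0 = fun x => expR (- (c * x))).
    by apply: is_derive_eq; rewrite expr1 expr0 divr1 mul1r mulNr.
  by apply/funext => y; rewrite /erlang_tail big_ord1 expr0 divr1 mulr1.
have dX : is_derive x 1 ((@id R) ^+ n.+1) (n.+1%:R * x ^+ n).
  by apply: is_derive_eq; rewrite /= /GRing.scale /= mulr1.
have := is_deriveD IH (is_deriveZ (c ^+ n.+1 / (n.+1`!)%:R) (is_deriveM dX dexp)).
rewrite (_ : erlang_tail c n.+1 = erlang_tail c n +
   c ^+ n.+1 / (n.+1`!)%:R *: (id ^+ n.+1 * (fun x => expR (- (c * x)))))%R.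
  move=> h; apply: is_derive_eq h _.
  rewrite exprfctE /GRing.scale /= factS natrM !exprS.
  have := natr_fact_neq0 R n; have : n.+1%:R != 0 :> R by rewrite pnatr_eq0.
  move=> h1 h2; field.
  by rewrite h2 /= -natr1 in h1 *.
apply/funext => y; rewrite /erlang_tail !fctE [in LHS]big_ord_recr/= mulrDr exprMn.
by congr (_ + _); rewrite /GRing.scale/=; ring.
Qed.

(** From [y <= exp y] at [y = x / (n + 1)], raised to the power [n + 1], the function is at most
    [(n + 1)^(n + 1) / x] for [x > 0]. *)
Lemma cvg_exprn_expRN (R : realType) n :
  (x ^+ n * expR (- x)) @[x --> +oo] --> (0 : R).
Proof.
apply/cvgrPdist_le => e e0; near=> x.
have x0 : 0 < x by near: x; exact: nbhs_pinfty_gt.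
rewrite sub0r normrN ger0_norm ?mulr_ge0 ?exprn_ge0 ?expR_ge0 ?(ltW x0)//.
rewrite expRN ler_pdivrMr ?expR_gt0//.
have n0 : 0 < n.+1%:R :> R by [].
have expx : (x / n.+1%:R) ^+ n.+1 <= expR x.
  rewrite -[in leRHS](divfK (lt0r_neq0 n0) x) expRM_natr lerXn2r ?nnegrE ?expR_ge0//.
    by rewrite divr_ge0 ?(ltW x0).
  by rewrite (le_trans _ (expR_ge1Dx _))// lerDr.
have xe : n.+1%:R ^+ n.+1 / e <= x by near: x; apply: nbhs_pinfty_ge; rewrite num_real.
rewrite -ler_pdivrMl// (le_trans _ expx)// expr_div_n ler_pdivlMr ?exprn_gt0//.
by rewrite [x ^+ n.+1]exprS mulrAC ler_wpM2r ?exprn_ge0 ?(ltW x0)// mulrC.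
Unshelve. all: end_near. Qed.

Lemma continuous_exprn_expRN (R : realType) (c : R) n :
  continuous (fun x : R => x ^+ n * expR (- (c * x))).
Proof.
move=> x; apply: cvgM; first exact: exprn_continuous.
apply: continuous_comp; last exact: continuous_expR.
by apply: cvgN; apply: cvgM; [exact: cvg_cst|exact: cvg_id].
Qed.

Lemma measurable_exprn_expRN (R : realType) (c : R) n :
  measurable_fun [set: R] (fun x : R => x ^+ n * expR (- (c * x))).
Proof. by apply: continuous_measurable_fun; exact: continuous_exprn_expRN. Qed.

Lemma cvg_erlang_tail (R : realType) (c : R) n : 0 < c ->
  erlang_tail c n x @[x --> +oo] --> (0 : R).
Proof.
move=> c0.
suff h : (expR (- y) * \sum_(k < n.+1) y ^+ k / (k`!)%:R) @[y --> +oo] --> (0 : R).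
  apply: (@cvg_comp _ _ _ (fun x => c * x) _ _ (pinfty_nbhs R)) h.
  exact: gt0_cvgMry.
elim: n => [|n IH].
  rewrite (_ : (fun y : R => _) = fun y => y ^+ 0 * expR (- y)).
    exact: cvg_exprn_expRN.
  by apply/funext => y; rewrite big_ord1 expr0 divr1 mulr1 mul1r.
rewrite (_ : (fun y : R => _) = fun y =>
    expR (- y) * (\sum_(k < n.+1) y ^+ k / (k`!)%:R) +
    (n.+1`!)%:R^-1 * (y ^+ n.+1 * expR (- y))).
  have := cvgD IH (cvgMl_tmp (a := (n.+1`!)%:R^-1) (cvg_exprn_expRN R n.+1)).
  rewrite mulr0 addr0; by apply.
by apply/funext => y; rewrite big_ord_recr/=; ring.
Qed.

Lemma erlang_tail0 (R : realType) (c : R) n : erlang_tail c n 0 = 1.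
Proof.
rewrite /erlang_tail mulr0 oppr0 expR0 mul1r big_ord_recl expr0 divr1.
by rewrite big1 ?addr0// => k _; rewrite expr0n mul0r.
Qed.

Lemma continuous_erlang_tail (R : realType) (c : R) n :
  continuous (erlang_tail c n).
Proof.
move=> x; apply: differentiable_continuous; apply/derivable1_diffP.
by have [] := is_derive_erlang_tail R c n x.
Qed.

(** A negative multiple of [erlang_tail] is an antiderivative; it vanishes at infinity and its value
    at [0] gives the result. *)
Lemma integral_exprn_expRN (R : realType) (c : R) n : 0 < c ->
  (\int[@lebesgue_measure R]_(x in `[0%R, +oo[) (x ^+ n * expR (- (c * x)))%:E =
   ((n`!)%:R / c ^+ n.+1)%:E)%E.
Proof.
move=> c0.
have cn0 : c ^+ n.+1 != 0 by rewrite expf_neq0// gt_eqF.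
have n0 := natr_fact_neq0 R n.
pose F (x : R) : R := - ((n`!)%:R / c ^+ n.+1) * erlang_tail c n x.
have dF (x : R) : is_derive x 1 F (x ^+ n * expR (- (c * x))).
  have := is_deriveZ (- ((n`!)%:R / c ^+ n.+1)) (is_derive_erlang_tail R c n x).
  move=> h; apply: is_derive_eq h _.
  by rewrite /GRing.scale/=; field; rewrite cn0 n0.
rewrite (@ge0_continuous_FTC2y _ _ F _ 0).
- by rewrite sub0e /F erlang_tail0 mulr1 EFinN oppeK.
- by move=> x x0; rewrite mulr_ge0 ?exprn_ge0 ?expR_ge0.
- exact/continuous_subspaceT/continuous_exprn_expRN.
- have := cvgMl_tmp (a := - ((n`!)%:R / c ^+ n.+1)) (cvg_erlang_tail R c n c0).
  rewrite mulr0; by apply.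
- by move=> x _; have [] := dF x.
- apply: cvg_at_right_filter; apply: cvgM; first exact: cvg_cst.
  exact: continuous_erlang_tail.
- by move=> x _; rewrite derive1E; have [_ ] := dF x.
Qed.

Lemma integral_erlang_pdf (R : realType) (c : R) n (x : R) : 0 < x ->
  (\int[@lebesgue_measure R]_(t in `[0%R, x])
     (c ^+ n.+1 / (n`!)%:R * (t ^+ n * expR (- (c * t))))%:E =
   (1 - erlang_tail c n x)%:E)%E.
Proof.
move=> x0.
pose F : R -> R := - erlang_tail c n.
have dF (y : R) : is_derive y 1 F (c ^+ n.+1 / (n`!)%:R * (y ^+ n * expR (- (c * y)))).
  have h := is_deriveN (is_derive_erlang_tail R c n y).
  by apply: is_derive_eq h _; rewrite opprK.
have cF : continuous F.
  by move=> y; apply: cvgN; exact: continuous_erlang_tail.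
rewrite (@continuous_FTC2 _ _ F)//.
- by rewrite /F !fctE erlang_tail0 -EFinD opprK addrC.
- apply: continuous_subspaceT => y; apply: cvgM; first exact: cvg_cst.
  exact: continuous_exprn_expRN.
- split.
  + by move=> y _; have [] := dF y.
  + exact/cvg_at_right_filter/cF.
  + exact/cvg_at_left_filter/cF.
- by move=> y _; rewrite derive1E; have [_ ] := dF y.
Qed.

Lemma Gamma_natS (R : realType) n : Gamma (n.+1%:R : R) = (n`!)%:R.
Proof.
transitivity (fine (\int[@lebesgue_measure R]_(t in `]0%R, +oo[)
    (t ^+ n * expR (- (1 * t)))%:E)%E).
  congr fine; apply: eq_integral => t; rewrite inE/= in_itv/= andbT => t0.
  by rewrite -natr1 addrK powR_mulrn ?ltW// mul1r.
rewrite integral_itv_obnd_cbnd ?integral_exprn_expRN//= ?expr1n ?divr1//.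
by apply/measurable_EFinP; apply: measurable_funTS; exact: measurable_exprn_expRN.
Qed.

(** * The incomplete Gamma integral *)

(** Extending [f] by zero outside [A * B] keeps it nonnegative and measurable, which reduces the
    claim to Tonelli on the whole product space. *)
Lemma fubini_tonelli_setX {d1 d2 : measure_display} {T1 : measurableType d1}
    {T2 : measurableType d2} {R : realType}
    (m1 : {sigma_finite_measure set T1 -> \bar R})
    (m2 : {sigma_finite_measure set T2 -> \bar R})
    (A : set T1) (B : set T2) (f : T1 * T2 -> \bar R) :
  measurable A -> measurable B -> measurable_fun (A `*` B) f ->
  (forall x y, A x -> B y -> 0 <= f (x, y))%E ->
  (\int[m1]_(x in A) \int[m2]_(y in B) f (x, y) =
   \int[m2]_(y in B) \int[m1]_(x in A) f (x, y))%E.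
Proof.
move=> mA mB mf f0.
pose g := (f \_ (A `*` B))%E.
have mg : measurable_fun setT g.
  by apply/(measurable_restrictT _ _).1 => //; exact: measurableX.
have g0 z : (0 <= g z)%E.
  rewrite /g patchE; case: ifPn => // /set_mem; case: z => x y /= [Ax By].
  exact: f0.
rewrite integral_mkcond [RHS]integral_mkcond.
transitivity (\int[m1]_x \int[m2]_y g (x, y))%E.
  apply: eq_integral => x _; rewrite patchE; case: ifPn => [/set_mem Ax|xA].
    rewrite integral_mkcond; apply: eq_integral => y _; rewrite /g !patchE.
    case: ifPn => [/set_mem By|yB]; first by rewrite mem_set.
    by rewrite memNset// => -[_ /mem_set]; exact/negP.
  rewrite integral0_eq// => y _; rewrite /g patchE memNset// => -[/mem_set Ax _].
  by rewrite Ax in xA.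
rewrite (fubini_tonelli g)//.
apply: eq_integral => y _; rewrite [RHS]patchE; case: ifPn => [/set_mem By|yB].
  rewrite [RHS]integral_mkcond; apply: eq_integral => x _; rewrite /g !patchE.
  case: ifPn => [/set_mem[Ax _]|nAB]; first by rewrite mem_set.
  case: ifPn => // /set_mem Ax; case/negP: nAB; exact/mem_set.
rewrite integral0_eq// => x _; rewrite /g patchE memNset// => -[_ /mem_set By].
by rewrite By in yB.
Qed.

Lemma integral_itvcy_expRN (R : realType) (a z : R) : 0 < a ->
  (\int[@lebesgue_measure R]_(t in `[z, +oo[) (expR (- (a * t)))%:E =
   (expR (- (a * z)) / a)%:E)%E.
Proof.
move=> a0.
have ane0 : a != 0 by rewrite gt_eqF.
pose F (x : R) : R := - a^-1 * erlang_tail a 0 x.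
have dF (x : R) : is_derive x 1 F (expR (- (a * x))).
  have h := is_deriveZ (- a^-1) (is_derive_erlang_tail R a 0 x).
  by apply: is_derive_eq h _; rewrite /GRing.scale/=; rewrite expr1 divr1 mul1r; field.
rewrite (@ge0_continuous_FTC2y _ _ F _ 0).
- rewrite sub0e /F /erlang_tail big_ord1 expr0 divr1 mulr1 -EFinN.
  by congr EFin; ring.
- by move=> x _; exact: expR_ge0.
- apply: continuous_subspaceT => x.
  have := continuous_exprn_expRN R a 0 x.
  by rewrite (_ : (fun x : R => _) = fun x => expR (- (a * x)))//;
    apply/funext => y; rewrite mul1r.
- have := cvgMl_tmp (a := - a^-1) (cvg_erlang_tail R a 0 a0).
  by rewrite mulr0; apply.
- by move=> x _; have [] := dF x.
- apply: cvg_at_right_filter; apply: cvgM; first exact: cvg_cst.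
  exact: continuous_erlang_tail.
- by move=> x _; rewrite derive1E; have [_ ] := dF x.
Qed.

(** Writing the inverse of [x] as [x] times the real power [-1] of [x ^+ 2] keeps the base of the
    power nonnegative, and both sides are [0] at [x = 0]. *)
Lemma measurable_invr (R : realType) : measurable_fun [set: R] (@GRing.inv R).
Proof.
rewrite (_ : GRing.inv = fun x : R => x * (x ^+ 2) `^ (-1)).
  apply: measurable_funM => //.
  apply: (@measurableT_comp _ _ _ _ _ _ (fun y : R => y `^ (-1))).
    exact: measurable_powR.
  exact: measurable_funX.
apply/funext => x; rewrite powR_inv1 ?sqr_ge0// expr2.
have [->|x0] := eqVneq x 0; first by rewrite invr0 mul0r.
by field.
Qed.

Lemma measurable_funV {d} {T : measurableType d} {R : realType} (D : set T)
  (f : T -> R) : measurable_fun D f -> measurable_fun D (fun x => (f x)^-1).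
Proof. by move=> mf; exact: (measurableT_comp (measurable_invr R)). Qed.

Section exponential_integral.
Context {R : realType}.
Variables (p c : R) (n : nat).
Hypotheses (p0 : 0 < p) (c0 : 0 < c).
Let mu := @lebesgue_measure R.

Lemma measurable_exp_rational :
  measurable_fun [set: R] (fun x : R => x ^+ n * expR (- (p * x)) * (c / (1 + c * x))).
Proof.
apply: measurable_funM; first exact: measurable_exprn_expRN.
apply: measurable_funM => //.
by apply: measurable_funV; apply: measurable_funD => //; exact: measurable_funM.
Qed.

Lemma exp_rational_ge0 x : 0 <= x -> 0 <= x ^+ n * expR (- (p * x)) * (c / (1 + c * x)).
Proof.
move=> x0.
by rewrite !mulr_ge0 ?exprn_ge0 ?expR_ge0 ?invr_ge0 ?addr_ge0 ?mulr_ge0// ltW.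
Qed.

(** On the half-line [1 + c x >= 1], so the integrand is dominated by [c x^n exp(- p x)]. *)
Lemma integral_exp_rational_lty :
  (\int[mu]_(x in `[0%R, +oo[)
     (x ^+ n * expR (- (p * x)) * (c / (1 + c * x)))%:E < +oo)%E.
Proof.
apply: (@le_lt_trans _ _
  (\int[mu]_(x in `[0%R, +oo[) (c%:E * (x ^+ n * expR (- (p * x)))%:E))%E).
  apply: ge0_le_integral => //.
  - by move=> x /=; rewrite in_itv/= andbT => x0; rewrite lee_fin exp_rational_ge0.
  - by apply/measurable_EFinP; apply: measurable_funTS; exact: measurable_exp_rational.
  - apply/measurable_EFinP; apply: measurable_funTS; apply: measurable_funM => //.
    exact: measurable_exprn_expRN.
  - move=> x /=; rewrite in_itv/= andbT => x0.
    rewrite -EFinM lee_fin [leRHS]mulrC ler_wpM2l ?mulr_ge0 ?exprn_ge0 ?expR_ge0//.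
    rewrite ler_pdivrMr; last by rewrite ltr_pwDl// mulr_ge0// ltW.
    by rewrite ler_peMr ?(ltW c0)// lerDl mulr_ge0// ltW.
rewrite ge0_integralZl//.
- by rewrite integral_exprn_expRN// -EFinM ltry.
- by apply/measurable_EFinP; apply: measurable_funTS; exact: measurable_exprn_expRN.
- move=> x /=; rewrite in_itv/= andbT => x0.
  by rewrite lee_fin !mulr_ge0 ?exprn_ge0 ?expR_ge0.
- by rewrite lee_fin ltW.
Qed.

(* Tonelli, after writing [n`! / t ^+ n.+1] as the Laplace transform of [x ^+ n]. *)
Lemma integral_exp_rational :
  (\int[mu]_(x in `[0%R, +oo[) (x ^+ n * expR (- (p * x)) * (c / (1 + c * x)))%:E =
   ((n`!)%:R / c ^+ n * (expR (p / c) * upper_gamma (- n%:R) (p / c)))%:E)%E.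
Proof.
set J := (LHS).
have Jfin : J \is a fin_num.
  rewrite ge0_fin_numE ?integral_exp_rational_lty//.
  apply: integral_ge0 => x /=; rewrite in_itv/= andbT => x0.
  by rewrite lee_fin exp_rational_ge0.
pose z := p / c.
have z0 : 0 < z by rewrite divr_gt0.
(* Integrating this kernel over [x] gives [n! t^(-n-1) exp(-t)], the integrand of [U]. Integrating
   over [t >= z] gives the integrand of [J] times [c^n exp(-z)], because [(1 + c x) z = z + p x]. *)
pose K (q : R * R) := c ^+ n.+1 * (q.2 ^+ n * expR (- (q.1 * (1 + c * q.2)))).
pose U := (\int[mu]_(t in `[z, +oo[) (powR t (- n%:R - 1) * expR (- t))%:E)%E.
have : ((n`!)%:R%:E * U = (c ^+ n * expR (- z))%:E * J)%E.
  transitivity (\int[mu]_(t in `[z, +oo[) \int[mu]_(x in `[0%R, +oo[) (K (t, x))%:E)%E.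
    rewrite -ge0_integralZl//; last 2 first.
    - apply/measurable_EFinP; apply: measurable_funTS; apply: measurable_funM.
        exact: measurable_powR.
      by apply: measurableT_comp => //; exact: measurable_funN.
    - by move=> t _; rewrite lee_fin mulr_ge0 ?powR_ge0 ?expR_ge0.
    apply: eq_integral => t; rewrite inE/= in_itv/= andbT => zt.
    have t0 : 0 < t by exact: lt_le_trans zt.
    rewrite /K /=.
    under eq_integral => x _.
      rewrite (_ : _ * _ = c ^+ n.+1 * expR (- t) *
        (x ^+ n * expR (- (t * c * x)))); last first.
        by rewrite (_ : - (t * _) = - t + - (t * c * x)) ?expRD; ring.
      rewrite EFinM; over.
    rewrite ge0_integralZl//; last 3 first.
    - by apply/measurable_EFinP; apply: measurable_funTS; exact: measurable_exprn_expRN.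
    - move=> x /=; rewrite in_itv/= andbT => x0.
      by rewrite lee_fin !mulr_ge0 ?exprn_ge0 ?expR_ge0.
    - by rewrite lee_fin !mulr_ge0 ?exprn_ge0 ?expR_ge0// ltW.
    rewrite integral_exprn_expRN ?mulr_gt0// -!EFinM; congr EFin.
    have -> : t `^ (- n%:R - 1) = (t ^+ n.+1)^-1.
      by rewrite -opprD natr1 powR_invn// ltW.
    rewrite exprMn.
    have : c ^+ n.+1 != 0 by rewrite expf_neq0// gt_eqF.
    have : t ^+ n.+1 != 0 by rewrite expf_neq0// gt_eqF.
    by move=> h1 h2; field; rewrite h1 h2.
  rewrite (fubini_tonelli_setX mu mu _ _ (EFin \o K))//; last 2 first.
  - apply/measurable_EFinP; apply: measurable_funTS.
    apply: measurable_funM => //; apply: measurable_funM.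
      exact: measurable_funX.
    apply: measurableT_comp => //; apply: measurable_funN.
    apply: measurable_funM => //; apply: measurable_funD => //.
    exact: measurable_funM.
  - move=> t x /=; rewrite !in_itv/= !andbT => zt x0.
    by rewrite lee_fin /K !mulr_ge0 ?exprn_ge0 ?expR_ge0// ltW.
  rewrite -ge0_integralZl//; last 3 first.
  - by apply/measurable_EFinP; apply: measurable_funTS; exact: measurable_exp_rational.
  - by move=> x /=; rewrite in_itv/= andbT => x0; rewrite lee_fin exp_rational_ge0.
  - by rewrite lee_fin mulr_ge0 ?expR_ge0 ?exprn_ge0// ltW.
  apply: eq_integral => x; rewrite inE/= in_itv/= andbT => x0.
  have cx0 : 0 < 1 + c * x by rewrite ltr_pwDl// mulr_ge0// ltW.
  rewrite /K /=.
  under eq_integral => t _.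
    rewrite mulrA (mulrC t) EFinM; over.
  rewrite ge0_integralZl//; last 2 first.
  - apply/measurable_EFinP; apply: measurable_funTS.
    by apply: measurableT_comp => //; apply: measurable_funN; exact: measurable_funM.
  - by rewrite lee_fin !mulr_ge0 ?exprn_ge0// ltW.
  rewrite integral_itvcy_expRN// -!EFinM; congr EFin.
  have -> : - ((1 + c * x) * z) = - z - p * x.
    by rewrite /z; field; rewrite gt_eqF.
  by rewrite expRD exprS; field; rewrite gt_eqF.
(* Finiteness of [J] forces [U] to be finite, so the extended-real identity can be solved for [U]
   before [fine] is applied. *)
rewrite -/U -(fineK Jfin) => UJ.
have n0 := natr_fact_neq0 R n.
have cn0 : c ^+ n != 0 by rewrite expf_neq0// gt_eqF.
have en0 : expR z != 0 by rewrite gt_eqF// expR_gt0.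
rewrite /upper_gamma -/mu -/z -/U.
rewrite (_ : U = ((n`!)%:R^-1 * (c ^+ n * expR (- z) * fine J))%:E) /=.
  by congr EFin; rewrite expRN; field; rewrite n0 cn0 en0.
by rewrite EFinM [X in (_ * X)%E]EFinM -UJ muleA -EFinM mulVf// mul1e.
Qed.
End exponential_integral.

(** * Distribution of the selection-combining gains *)

(** The density vanishes on the nonpositive axis, and its constant [Gamma (m + 1)] is [m!], so it is
    minus the derivative of [erlang_tail] on the rest. *)
Lemma gamma_density_cdf {d : measure_display} {T : measurableType d} {R : realType}
    (P : probability T R) (X : T -> R) (m : nat) (Om x : R) :
  0 < Om -> 0 <= x -> has_density P X (gamma_pdf m.+1 Om) ->
  P (X @^-1` `]-oo, x]) = (1 - erlang_tail (m.+1%:R / Om) m x)%:E.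
Proof.
move=> Om0 x0 -> //.
set c := m.+1%:R / Om.
transitivity (\int[@lebesgue_measure R]_(t in `]0%R, x])
    (c ^+ m.+1 / (m`!)%:R * (t ^+ m * expR (- (c * t))))%:E)%E.
  rewrite integral_mkcond [RHS]integral_mkcond; apply: eq_integral => t _.
  rewrite !patchE !mem_setE !in_itv/= /gamma_pdf.
  case: (ltP 0 t) => t0 /=; last by case: ifP.
  case: ifP => // _; rewrite Gamma_natS -/c; congr EFin.
  by rewrite (_ : m.+1%:R * t / Om = c * t) /c; [ring|rewrite mulrAC].
rewrite integral_itv_obnd_cbnd; last first.
  apply/measurable_EFinP; apply: measurable_funTS; apply: measurable_funM => //.
  exact: measurable_exprn_expRN.
(* At [x = 0] the interval is a null singleton; the antiderivative formula covers only [0 < x]. *)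
move: x0; rewrite le_eqVlt => /predU1P[<-|x0].
  by rewrite set_itv1 integral_set1 erlang_tail0 subrr.
by rewrite integral_erlang_pdf.
Qed.

Lemma prob_setI_setC {d : measure_display} {T : measurableType d} {R : realType}
    (P : probability T R) (A B : set T) (a b : R) :
  measurable A -> measurable B ->
  P A = a%:E -> P B = b%:E -> P (A `&` B) = (a * b)%:E ->
  P (~` A `&` ~` B) = ((1 - a) * (1 - b))%:E.
Proof.
move=> mA mB PA PB PAB.
have fin C : measurable C -> (P C < +oo)%E.
  by move=> mC; rewrite (le_lt_trans (probability_le1 _ mC))// ltry.
have mnA : measurable (~` A) by exact: measurableC.
have e1 : (P (~` A `\` B) = P (~` A) - P (~` A `&` B))%E.
  by apply: measureD => //; exact: fin.
have e2 : (P (B `\` A) = P B - P (B `&` A))%E by apply: measureD => //; exact: fin.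
rewrite -setDE e1 [~` A `&` B]setIC -setDE e2 (probability_setC _ mA) setIC.
by rewrite PA PB PAB -!EFinB; congr EFin; ring.
Qed.

(** For [n > 0] the seed of the maximum is the first value of the family, so it adds no constraint
    of its own. *)
Lemma sc_max_leP {R : realType} (n : nat) (F : 'I_n -> R) (t : R) : (0 < n)%N ->
  sc_max F <= t <-> forall i, F i <= t.
Proof.
case: n F => // n F _; rewrite /sc_max big_map big_enum; split.
  by move=> /bigmax_leP[_ h] i; exact: h.
by move=> h; apply/bigmax_leP; split => [|i _]; rewrite ?enum_ordSl ?h.
Qed.

Lemma measurable_sc_max {d : measure_display} {T : measurableType d} {R : realType}
    (n : nat) (F : 'I_n -> T -> R) : (forall i, measurable_fun [set: T] (F i)) ->
  measurable_fun [set: T] (fun w => sc_max (F ^~ w)).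
Proof.
move=> mF; rewrite /sc_max.
under eq_fun do rewrite big_map.
(* The seed depends on [w] as well, hence the induction over an arbitrary measurable seed. *)
have mbig (s : seq 'I_n) (h : T -> R) : measurable_fun [set: T] h ->
    measurable_fun [set: T] (fun w => \big[Num.max/h w]_(i <- s) F i w).
  move=> mh; elim: s => [|i s IH]; first by under eq_fun do rewrite big_nil.
  by under eq_fun do rewrite big_cons; exact: measurable_maxr.
apply: mbig; case: (enum 'I_n) => [|i s] //=.
Qed.

(** Layer-cake formula: where [X w > 0], [h (X w)] integrates [g] over the [t >= 0] below [X w], up
    to one endpoint, and Tonelli exchanges [w] and [t]. *)
Lemma integral_comp_tail {d : measure_display} {T : measurableType d} {R : realType}
    (P : probability T R) (X : T -> R) (h g : R -> R) :
  measurable_fun [set: T] X -> measurable_fun [set: R] g ->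
  (forall t, 0 <= t -> 0 <= g t) ->
  (forall x, 0 < x ->
    (h x)%:E = (\int[@lebesgue_measure R]_(t in `[0%R, x]) (g t)%:E)%E) ->
  (\int[P]_(w in X @^-1` `]0%R, +oo[) (h (X w))%:E =
   \int[@lebesgue_measure R]_(t in `[0%R, +oo[) ((g t)%:E * P (X @^-1` `]t, +oo[)))%E.
Proof.
move=> mX mg g0 hg.
pose f (q : T * R) := if q.2 < X q.1 then g q.2 else 0.
have mXt t : measurable (X @^-1` `]t, +oo[).
  by rewrite -[X in measurable X]setTI; exact: mX.
transitivity (\int[P]_(w in X @^-1` `]0%R, +oo[)
   \int[@lebesgue_measure R]_(t in `[0%R, +oo[) (f (w, t))%:E)%E.
  apply: eq_integral => w; rewrite inE/= in_itv/= andbT => Xw.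
  rewrite hg// -integral_itv_bndo_bndc; last first.
    by apply/measurable_EFinP; exact: measurable_funTS.
  rewrite integral_mkcond [RHS]integral_mkcond; apply: eq_integral => t _.
  rewrite !patchE !mem_setE !in_itv/= andbT /f /=.
  by case: (leP 0 t) => //= _; case: ltP.
rewrite (fubini_tonelli_setX P (@lebesgue_measure R) _ _ (EFin \o f))//; last 2 first.
- apply/measurable_EFinP; apply: measurable_funTS; apply: measurable_fun_ifT => //.
    apply: measurable_fun_ltr => //.
    exact: (measurableT_comp mX).
  exact: (measurableT_comp mg).
- move=> w t /= _; rewrite in_itv/= andbT => t0.
  by rewrite lee_fin /f /=; case: ifP => // _; exact: g0.
apply: eq_integral => t; rewrite inE/= in_itv/= andbT => t0.
transitivity (\int[P]_(w in X @^-1` `]t, +oo[) (g t)%:E)%E; last first.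
  by rewrite integral_cst.
rewrite integral_mkcond [RHS]integral_mkcond.
have memX s w : (w \in X @^-1` `]s, +oo[) = (s < X w).
  apply/idP/idP => [|sX]; first by rewrite inE /= in_itv/= andbT.
  by apply/mem_set; rewrite /= in_itv/= andbT.
(* Since [0 <= t], the event [t < X w] already lies inside the domain [0 < X w]. *)
apply: eq_integral => w _; rewrite !patchE !memX /f /=.
case: (ltP t (X w)) => tX; last by case: ifP.
by rewrite (le_lt_trans t0 tX).
Qed.

Lemma prob_min_sc_max_gt {d : measure_display} {T : measurableType d} {R : realType}
    (P : probability T R) (Nr Nd : nat) (Gsr : 'I_Nr -> T -> R)
    (Gsd Grd : 'I_Nd -> T -> R) (t p q : R) :
  (0 < Nr)%N -> (0 < Nd)%N ->
  (forall i, measurable_fun [set: T] (Gsr i)) ->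
  (forall j, measurable_fun [set: T] (Gsd j)) ->
  mutually_independent P (all_gains Gsr Gsd Grd) ->
  (forall i, P (Gsr i @^-1` `]-oo, t]) = p%:E) ->
  (forall j, P (Gsd j @^-1` `]-oo, t]) = q%:E) ->
  P ((fun w => Num.min (sc_max (Gsr ^~ w)) (sc_max (Gsd ^~ w))) @^-1` `]t, +oo[) =
  ((1 - p ^+ Nr) * (1 - q ^+ Nd))%:E.
Proof.
move=> Nr0 Nd0 mGsr mGsd ind Pp Pq.
have mItv (F : T -> R) : measurable_fun [set: T] F -> measurable (F @^-1` `]-oo, t]).
  by move=> mF; rewrite -[X in measurable X]setTI; exact: mF.
pose A := (fun w => sc_max (Gsr ^~ w)) @^-1` `]-oo, t].
pose B := (fun w => sc_max (Gsd ^~ w)) @^-1` `]-oo, t].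
have AE w : A w <-> forall i, Gsr i w <= t.
  by rewrite /A /= in_itv/=; exact: sc_max_leP.
have BE w : B w <-> forall j, Gsd j w <= t.
  by rewrite /B /= in_itv/=; exact: sc_max_leP.
rewrite (_ : _ @^-1` _ = ~` A `&` ~` B); last first.
  apply/seteqP; split => w /=; rewrite in_itv/= andbT lt_min.
    by move=> /andP[h1 h2]; split; rewrite /A /B /= in_itv/= leNgt ?h1 ?h2.
  by rewrite /A /B /= !in_itv/= => -[/negP + /negP]; rewrite -!ltNge => -> ->.
(* Independence is stated for the whole family, so an unconstrained gain gets the full line, of
   probability [1]. The flags [a], [b] select the events [A], [B] or their intersection. *)
pose S (a b : bool) (i : ('I_Nr + 'I_Nd + 'I_Nd)%type) : set R :=
  match i with
  | inl (inl _) => if a then `]-oo, t]%classic else setT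
  | inl (inr _) => if b then `]-oo, t]%classic else setT
  | inr _ => setT
  end.
have PS a b : P (\bigcap_(i in [set: _]) (all_gains Gsr Gsd Grd i @^-1` S a b i)) =
    ((if a then p ^+ Nr else 1) * (if b then q ^+ Nd else 1))%:E.
  rewrite ind; last by case=> [[]|] ? /=; [case: a|case: b|].
  rewrite !big_sumType /=.
  rewrite [X in (_ * X)%E]big1 ?mule1; last first.
    by move=> k _; rewrite preimage_setT probability_setT.
  rewrite EFinM; congr (_ * _)%E.
    case: a; last by rewrite big1// => k _; rewrite preimage_setT probability_setT.
    under eq_bigr do rewrite Pp.
    by rewrite -(big_morph EFin EFinM erefl) prodr_const card_ord.
  case: b; last by rewrite big1// => k _; rewrite preimage_setT probability_setT.
  under eq_bigr do rewrite Pq.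
  by rewrite -(big_morph EFin EFinM erefl) prodr_const card_ord.
apply: prob_setI_setC.
- by apply: mItv; exact: measurable_sc_max.
- by apply: mItv; exact: measurable_sc_max.
- have := PS true false; rewrite mulr1 => <-; congr (P _).
  apply/seteqP; split => w.
    by move=> /AE h [[i|j]|k] _ //=; rewrite in_itv/=.
  by move=> h; apply/AE => i; have := h (inl (inl i)) I; rewrite /= in_itv.
- have := PS false true; rewrite mul1r => <-; congr (P _).
  apply/seteqP; split => w.
    by move=> /BE h [[i|j]|k] _ //=; rewrite in_itv/=.
  by move=> h; apply/BE => i; have := h (inl (inr i)) I; rewrite /= in_itv.
- rewrite -(PS true true); congr (P _).
  apply/seteqP; split => w.
    by move=> [/AE hA /BE hB] [[i|j]|k] _ //=; rewrite in_itv/=.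
  move=> h; split; first by apply/AE => i; have := h (inl (inl i)) I; rewrite /= in_itv.
  by apply/BE => i; have := h (inl (inr i)) I; rewrite /= in_itv.
Qed.

(** * The ergodic capacity *)

Section capacity.
Context {R : realType}.
Variables (rho a1 a2 : R).
Hypotheses (rho0 : 0 < rho) (a20 : 0 < a2) (a21 : a2 < 1) (a12 : a1 + a2 = 1).

Definition capacity (x : R) : R :=
  2^-1 * log2 (1 + a1 * rho * x / (a2 * rho * x + 1)).

(** The derivative of [capacity] on [x >= 0]: with [a1 + a2 = 1] the argument of the logarithm is
    [(1 + rho x) / (1 + rho a2 x)]. *)
Definition capacity_density (x : R) : R :=
  (2 * ln 2)^-1 * (rho / (1 + rho * x) - rho * a2 / (1 + rho * a2 * x)).

Lemma measurable_capacity : measurable_fun [set: R] capacity.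
Proof.
have mM (c : R) : measurable_fun [set: R] ( *%R c) by exact: measurable_funM.
apply: measurable_funM => //; apply: measurable_funM => //.
apply: (@measurableT_comp _ _ _ _ _ _ (@ln R)); first exact: measurable_ln.
apply: measurable_funD => //.
by apply: measurable_funM => //; apply: measurable_funV; exact: measurable_funD.
Qed.

Lemma measurable_capacity_density : measurable_fun [set: R] capacity_density.
Proof.
have mD (c : R) : measurable_fun [set: R] (fun x => c / (1 + c * x)).
  apply: measurable_funM => //; apply: measurable_funV.
  by apply: measurable_funD => //; exact: measurable_funM.
by apply: measurable_funM => //; exact: measurable_funB.
Qed.

(** The map sending [c] to [c / (1 + c x)] is nondecreasing for [x >= 0], and [rho * a2 <= rho]. *)
Lemma capacity_density_ge0 x : 0 <= x -> 0 <= capacity_density x.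
Proof.
move=> x0; apply: mulr_ge0.
  by rewrite invr_ge0 mulr_ge0// ln_ge0// ler1n.
have r0 : 0 < 1 + rho * x by rewrite ltr_pwDl// mulr_ge0// ltW.
have ra0 : 0 < 1 + rho * a2 * x by rewrite ltr_pwDl// !mulr_ge0// ltW.
rewrite subr_ge0 ler_pdivrMr// mulrAC ler_pdivlMr//.
have : 0 <= rho * (1 - a2) by rewrite mulr_ge0// ltW// subr_gt0.
nra.
Qed.

Lemma integral_capacity_density x : 0 < x ->
  (capacity x)%:E =
  (\int[@lebesgue_measure R]_(t in `[0%R, x]) (capacity_density t)%:E)%E.
Proof.
move=> x0.
have pos (c y : R) : 0 < c -> 0 <= y -> 0 < 1 + c * y.
  by move=> c0 y0; rewrite ltr_pwDl// mulr_ge0// ltW.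
have ra0 : 0 < rho * a2 by rewrite mulr_gt0.
have dln (c y : R) : 0 < c -> 0 <= y ->
    is_derive y 1 (fun z => ln (1 + c * z)) (c / (1 + c * y)).
  move=> c0 y0.
  have dl := is_derive1_ln (pos c y c0 y0).
  have da : is_derive y 1 (fun z => 1 + c * z) c.
    by apply: is_derive_eq; rewrite /GRing.scale /=; ring.
  have := @is_derive1_comp _ _ (fun z => 1 + c * z) y _ _ dl da.
  by rewrite mulrC.
pose F (y : R) : R := (2 * ln 2)^-1 * (ln (1 + rho * y) - ln (1 + rho * a2 * y)).
have dF (y : R) : 0 <= y -> is_derive y 1 F (capacity_density y).
  move=> y0.
  exact: (is_deriveZ (2 * ln 2)^-1 (is_deriveB (dln _ _ rho0 y0) (dln _ _ ra0 y0))).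
have cF (y : R) : 0 <= y -> F z @[z --> y] --> F y.
  move=> y0; apply: differentiable_continuous; apply/derivable1_diffP.
  by have [] := dF _ y0.
rewrite (@continuous_FTC2 _ _ F)//.
- rewrite {2}/F !mulr0 !addr0 !ln1 subrr mulr0 sube0; congr EFin.
  have p1 := pos _ _ rho0 (ltW x0); have p2 := pos _ _ ra0 (ltW x0).
  rewrite /capacity /F -ln_div ?posrE//.
  rewrite /log2 (_ : 1 + _ / _ = (1 + rho * x) / (1 + rho * a2 * x)).
    by rewrite invfM mulrA mulrAC.
  have -> : a1 = 1 - a2 by rewrite -a12 addrK.
  have e : a2 * rho * x + 1 = 1 + rho * a2 * x by ring.
  by rewrite e; field; rewrite gt_eqF.
- apply: continuous_in_subspaceT => y; rewrite inE/= in_itv/= => /andP[y0 _].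
  have cinv (c : R) : 0 < c -> c / (1 + c * z) @[z --> y] --> c / (1 + c * y).
    move=> c0; apply: cvgM; first exact: cvg_cst.
    apply: cvgV; first by rewrite gt_eqF// pos.
    apply: cvgD; first exact: cvg_cst.
    by apply: cvgM; [exact: cvg_cst|exact: cvg_id].
  apply: cvgM; first exact: cvg_cst.
  by apply: cvgB; exact: cinv.
- split.
  + by move=> y /[!in_itv]/= /andP[/ltW y0 _]; have [] := dF _ y0.
  + exact/cvg_at_right_filter/cF.
  + exact/cvg_at_left_filter/cF/ltW.
- by move=> y /[!in_itv]/= /andP[/ltW y0 _]; rewrite derive1E; have [_] := dF _ y0.
Qed.
End capacity.

(** * Termwise integration and the closed form *)

Lemma integral_lincomb {d : measure_display} {T : measurableType d} {R : realType}
    (mu : {measure set T -> \bar R}) (D : set T) (I : finType) (Q : pred I)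
    (c J : I -> R) (F : I -> T -> R) :
  measurable D ->
  (forall i, Q i -> mu.-integrable D (EFin \o F i)) ->
  (forall i, Q i -> \int[mu]_(x in D) (F i x)%:E = (J i)%:E)%E ->
  (\int[mu]_(x in D) (\sum_(i | Q i) c i * F i x)%:E = (\sum_(i | Q i) c i * J i)%:E)%E.
Proof.
move=> mD iF FJ.
(* Terms outside [Q] are replaced by zero, so integrability holds for every index and the full
   finite sum can be integrated. *)
pose H i : T -> \bar R := if Q i then fun x => (c i * F i x)%:E else cst 0%E.
have iH i : mu.-integrable D (H i).
  rewrite /H; case: ifP => Qi; last exact: integrable0.
  under eq_fun do rewrite EFinM.
  by apply: integrableZl => //; exact: iF.
transitivity (\int[mu]_(x in D) \sum_i H i x)%E.
  apply: eq_integral => x _; rewrite -sumEFin big_mkcond; apply: eq_bigr => i _.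
  by rewrite /H; case: ifP.
rewrite integral_sum// -sumEFin [RHS]big_mkcond; apply: eq_bigr => i _.
rewrite /H; case: ifP => Qi; last by rewrite integral0.
under eq_integral do rewrite EFinM.
by rewrite integralZl ?FJ//; exact: iF.
Qed.

(** The expansion at [z = b t], [e = exp(- b t)], with powers of [t] and exponentials collected into
    the shape [t^n exp(- s t)] that is integrated later. *)
Lemma sub1_exp_erlang_tail (R : realType) (m N : nat) (b t : R) :
  1 - (1 - erlang_tail b m t) ^+ N =
  - \sum_(k in comps m.+1 N)
      (multinom k)%:R * (-1) ^+ (N - k ord0) * inv_fact_prod k * b ^+ tau_of k *
      (t ^+ tau_of k * expR (- ((N - k ord0)%:R * b * t))).
Proof.
rewrite /erlang_tail sub1_exp_erlang_cdf; congr (- _); apply: eq_bigr => k _.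
have -> : - ((N - k ord0)%:R * b * t) = - (b * t) * (N - k ord0)%:R by ring.
by rewrite expRM_natr exprMn; ring.
Qed.

Theorem theorem1 (R : realType) (d : measure_display) (T : measurableType d)
  (P : probability T R)
  (Nr Nd msr msd mrd : nat) (Osr Osd Ord rho a1 a2 : R)
  (Gsr : 'I_Nr -> {RV P >-> R}) (Gsd Grd : 'I_Nd -> {RV P >-> R}) :
  (0 < Nr)%N -> (0 < Nd)%N -> (0 < msr)%N -> (0 < msd)%N -> (0 < mrd)%N ->
  0 < Osr -> 0 < Osd -> 0 < Ord -> 0 < rho ->
  0 < a1 < 1 -> 0 < a2 < 1 -> a1 + a2 = 1 -> a2 < a1 ->
  (forall i, has_density P (Gsr i) (gamma_pdf msr Osr)) ->
  (forall j, has_density P (Gsd j) (gamma_pdf msd Osd)) ->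
  (forall k, has_density P (Grd k) (gamma_pdf mrd Ord)) ->
  mutually_independent P
    (all_gains (fun i => (Gsr i : T -> R)) (fun j => (Gsd j : T -> R))
               (fun k => (Grd k : T -> R))) ->
  let gsr := fun w => sc_max (fun i => Gsr i w) in
  let gsd := fun w => sc_max (fun j => Gsd j w) in
  let X := fun w => Num.min (gsr w) (gsd w) in
  ('E_P[fun w => (2^-1 * log2 (1 + a1 * rho * X w / (a2 * rho * X w + 1)))%R])%E =
  ((2 * ln 2)^-1 *
   \sum_(k in comps msr Nr) \sum_(l in comps msd Nd)
     let tau := tau_of k in
     let om := tau_of l in
     let Psi := (Nr - k ord0)%N%:R * msr%:R / Osr
              + (Nd - l ord0)%N%:R * msd%:R / Osd in
     (multinom k)%:R * (multinom l)%:R * (-1) ^+ (Nr + Nd - k ord0 - l ord0)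
     * inv_fact_prod k * (msr%:R / Osr) ^+ tau
     * inv_fact_prod l * (msd%:R / Osd) ^+ om
     * Gamma ((tau + om)%N%:R + 1) / rho ^+ (tau + om)
     * (expR (Psi / rho) * upper_gamma (- (tau + om)%N%:R) (Psi / rho)
        - (a2 ^+ (tau + om))^-1 * expR (Psi / (rho * a2))
          * upper_gamma (- (tau + om)%N%:R) (Psi / (rho * a2))))%:E.
Proof.
case: msr => [|msr]; first by [].
case: msd => [|msd]; first by [].
move=> Nr0 Nd0 _ _ _ Osr0 Osd0 _ rho0 _ /andP[a20 a21] a12 _ dsr dsd _ ind gsr gsd X.
set br := msr.+1%:R / Osr; set bd := msd.+1%:R / Osd.
have br0 : 0 < br by rewrite divr_gt0.
have bd0 : 0 < bd by rewrite divr_gt0.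
have ra0 : 0 < rho * a2 by rewrite mulr_gt0.
have mX : measurable_fun [set: T] X.
  by apply: measurable_minr; apply: measurable_sc_max => i; exact: measurable_funPT.
have tailX (t : R) : 0 <= t -> P (X @^-1` `]t, +oo[) =
    ((1 - (1 - erlang_tail br msr t) ^+ Nr) *
     (1 - (1 - erlang_tail bd msd t) ^+ Nd))%:E.
  move=> t0; apply: prob_min_sc_max_gt ind _ _ => //.
  - by move=> i; exact: gamma_density_cdf.
  - by move=> j; exact: gamma_density_cdf.
pose Xpos := X @^-1` `]0%R, +oo[.
have mXpos : measurable Xpos by rewrite -[X in measurable X]setTI; exact: mX.
(* The tail at [t = 0] is [(1 - 0^Nr) (1 - 0^Nd) = 1], since [Nr] and [Nd] are positive. *)
have PXneg : P (~` Xpos) = 0%E.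
  rewrite probability_setC// tailX// !erlang_tail0 !subrr !expr0n.
  by rewrite !gtn_eqF// !subr0 mulr1 subee.
pose pairs (p : {ffun 'I_msr.+2 -> 'I_Nr.+1} * {ffun 'I_msd.+2 -> 'I_Nd.+1}) :=
  (p.1 \in comps msr.+1 Nr) && (p.2 \in comps msd.+1 Nd).
pose n (p : {ffun 'I_msr.+2 -> 'I_Nr.+1} * {ffun 'I_msd.+2 -> 'I_Nd.+1}) :=
  (tau_of p.1 + tau_of p.2)%N.
pose Psi (p : {ffun 'I_msr.+2 -> 'I_Nr.+1} * {ffun 'I_msd.+2 -> 'I_Nd.+1}) : R :=
  (Nr - p.1 ord0)%:R * br + (Nd - p.2 ord0)%:R * bd.
pose C (p : {ffun 'I_msr.+2 -> 'I_Nr.+1} * {ffun 'I_msd.+2 -> 'I_Nd.+1}) : R :=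
  (2 * ln 2)^-1 *
  ((multinom p.1)%:R * (multinom p.2)%:R * (-1) ^+ (Nr + Nd - p.1 ord0 - p.2 ord0)
   * inv_fact_prod p.1 * br ^+ tau_of p.1 * inv_fact_prod p.2 * bd ^+ tau_of p.2).
pose K c p (t : R) := t ^+ n p * expR (- (Psi p * t)) * (c / (1 + c * t)).
pose J c p : R := ((n p)`!)%:R / c ^+ n p *
  (expR (Psi p / c) * upper_gamma (- (n p)%:R) (Psi p / c)).
(* Excluding [k_0 = Nr] and [l_0 = Nd] keeps every exponential rate positive, which makes each term
   integrable. *)
have Psi0 p : pairs p -> 0 < Psi p.
  have k0 m N (k : {ffun 'I_m.+1 -> 'I_N.+1}) : k \in comps m N -> (0 < N - k ord0)%N.
    by rewrite inE => /andP[_ kN]; rewrite subn_gt0 ltn_neqAle kN -ltnS ltn_ord.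
  by move=> /andP[/k0 k0p1 /k0 k0p2]; rewrite addr_gt0// mulr_gt0// ltr0n.
have iK c p : 0 < c -> pairs p ->
    (@lebesgue_measure R).-integrable `[0%R, +oo[ (EFin \o K c p).
  move=> c0 /Psi0 psi0; apply/integrableP; split.
    by apply/measurable_EFinP; apply: measurable_funTS; exact: measurable_exp_rational.
  apply: le_lt_trans (integral_exp_rational_lty _ _ (n p) psi0 c0).
  rewrite le_eqVlt; apply/orP; left; apply/eqP; apply: eq_integral => t.
  rewrite inE/= in_itv/= andbT => t0.
  by rewrite ger0_norm// exp_rational_ge0.
have JK c p : 0 < c -> pairs p ->
    (\int[@lebesgue_measure R]_(t in `[0%R, +oo[) (K c p t)%:E = (J c p)%:E)%E.
  by move=> c0 /Psi0 psi0; exact: integral_exp_rational.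
have expand (t : R) : capacity_density rho a2 t *
    ((1 - (1 - erlang_tail br msr t) ^+ Nr) * (1 - (1 - erlang_tail bd msd t) ^+ Nd)) =
    \sum_(p | pairs p) C p * (K rho p t - K (rho * a2) p t).
  rewrite !sub1_exp_erlang_tail mulrNN big_distrlr /= pair_big /= mulr_sumr.
  apply: eq_bigr => -[k l] _ /=.
  rewrite /C /K /capacity_density /Psi /n /= !exprD.
  (* Truncated subtraction splits here because [k ord0 <= Nr] and [l ord0 <= Nd]. *)
  have -> : (Nr + Nd - k ord0 - l ord0 = (Nr - k ord0) + (Nd - l ord0))%N.
    have := ltn_ord (k ord0); have := ltn_ord (l ord0); lia.
  have -> : - (((Nr - k ord0)%:R * br + (Nd - l ord0)%:R * bd) * t) =
      - ((Nr - k ord0)%:R * br * t) + - ((Nd - l ord0)%:R * bd * t) by ring.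
  rewrite exprD expRD.
  ring.
rewrite unlock.
(* The integral representation of [capacity] is available for positive arguments only; the
   complement of [Xpos] is a null set. *)
transitivity (\int[P]_(w in Xpos) (capacity rho a1 a2 (X w))%:E)%E.
  rewrite [RHS]integral_mkcond; apply: ae_eq_integral => //.
  - apply/measurable_EFinP; exact: (measurableT_comp (measurable_capacity rho a1 a2) mX).
  - apply/(measurable_restrictT _ _).1 => //.
    apply/measurable_EFinP; apply: measurable_funTS.
    exact: (measurableT_comp (measurable_capacity rho a1 a2) mX).
  - exists (~` Xpos); split => //; first exact: measurableC.
    move=> w /= h Xw; apply: h => _; by rewrite patchE mem_set.
rewrite (integral_comp_tail _ _ _ (capacity_density rho a2))//; last 3 first.
- exact: measurable_capacity_density.
- by move=> t; exact: capacity_density_ge0.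
- by move=> x; exact: integral_capacity_density.
transitivity (\int[@lebesgue_measure R]_(t in `[0%R, +oo[)
    (\sum_(p | pairs p) C p * (K rho p t - K (rho * a2) p t))%:E)%E.
  apply: eq_integral => t; rewrite inE/= in_itv/= andbT => t0.
  by rewrite tailX// -EFinM expand.
transitivity (\sum_(p | pairs p) C p * (J rho p - J (rho * a2) p))%:E.
  apply: integral_lincomb => // p Qp.
    rewrite (_ : EFin \o _ = (EFin \o K rho p) \- (EFin \o K (rho * a2)%R p))%E//.
    by apply: integrableB => //; exact: iK.
  under eq_integral do rewrite EFinB.
  by rewrite integralB//= ?JK//; exact: iK.
(* The factorial becomes [Gamma (n + 1)], and [(rho * a2)^n] splits so that [rho^n] factors out of
   both terms. *)
congr EFin; rewrite pair_big /= mulr_sumr; apply: eq_bigr => -[k l] _ /=.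
rewrite /C /J /n /Psi /= natr1 Gamma_natS.
rewrite -[_ * _ / Osr]mulrA -[_ * _ / Osd]mulrA -/br -/bd.
by rewrite [(rho * a2) ^+ _]exprMn [(rho ^+ _ * _)^-1]invfM; ring.
Qed.
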